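(* Let $\Phi=(\phi_n)$, $\Psi=(\psi_n)$ be sequences in $\mathcal H$, let $m=(m_n)$ be a complex scalar sequence, and let $M_{m,\Phi,\Psi}$ be unconditionally convergent. Then: (i) $(m_n\|\phi_n\|\psi_n)$ and $(m_n\|\psi_n\|\phi_n)$ are Bessel for $\mathcal H$. (ii) If $\Phi$ is NBB, then $m\Psi$ is Bessel for $\mathcal H$; if $\Psi$ is NBB, then $m\Phi$ is Bessel for $\mathcal H$; if $m\Phi$ is NBB, then $\Psi$ is Bessel for $\mathcal H$; if $m\Psi$ is NBB, then $\Phi$ is Bessel for $\mathcal H$. (iii) If both $\Phi$ and $\Psi$ are NBB, then $m\in\ell^\infty$. (iv) If $\Phi$, $\Psi$ and $m$ are NBB, then $m$ is semi-normalized and both $\Phi$ and $\Psi$ are Bessel for $\mathcal H$.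
   Context: $\mathcal H$ is a complex Hilbert space having an orthonormal basis $(e_n)_{n\in\mathbb N}$ indexed by $\mathbb N$; all sequences and sums are indexed by $\mathbb N$. The multiplier is $M_{m,\Phi,\Psi}f=\sum_{n=1}^\infty m_n\langle f,\psi_n\rangle\phi_n$. It is called unconditionally convergent if for every $f\in\mathcal H$ the series $\sum_n m_n\langle f,\psi_n\rangle\phi_n$ converges unconditionally (i.e. it converges for every permutation of its terms). Notation: $m\Phi=(m_n\phi_n)$. A sequence $(x_n)$ of scalars or vectors is NBB (norm-bounded below) if $\inf_n\|x_n\|>0$ (absolute value for scalars). A scalar sequence $m$ is semi-normalized if there are constants $0<a\le b<\infty$ with $a\le|m_n|\le b$ for all $n$. A sequence $(\phi_n)$ in $\mathcal H$ is Bessel for $\mathcal H$ if there is $B<\infty$ with $\sum_n|\langle h,\phi_n\rangle|^2\le B\|h\|^2$ for all $h\in\mathcal H$. *)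

(* Defs.v *)
From mathcomp Require Import all_boot all_order all_algebra.
From mathcomp Require Import sesquilinear.
From mathcomp Require Import all_classical all_reals all_analysis.
From mathcomp Require Import complex.
Import Order.TTheory GRing.Theory Num.Theory.
Import numFieldNormedType.Exports.

Set Implicit Arguments.
Unset Strict Implicit.
Unset Printing Implicit Defensive.

Local Open Scope classical_set_scope.
Local Open Scope ring_scope.
Local Open Scope complex_scope.

(* The norm of a normed space over R[i] is R[i]-valued (with values on the
   nonnegative real axis); [nrm] is the same norm as an element of R. *)
Definition nrm (R : realType) (V : normedZmodType R[i]) (x : V) : R :=
  complex.Re `|x|.

(* A complex Hilbert space is a complete normed space over R[i] whose norm is
   the one induced by an inner product. The forms {dot H for Num.conj} are
   linear in the first argument and conjugate-linear in the second. *)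
Definition induces_norm (R : realType) (H : completeNormedModType R[i])
    (dot : {dot H for Num.conj}) : Prop :=
  forall x : H, dot x x = `|x| ^+ 2.

Definition schauder_basis (R : realType) (H : completeNormedModType R[i])
    (e : nat -> H) : Prop :=
  forall f : H, exists! c : nat -> R[i],
    series (fun n => c n *: e n) @ \oo --> f.

Definition orthonormal_basis (R : realType) (H : completeNormedModType R[i])
    (dot : {dot H for Num.conj}) (e : nat -> H) : Prop :=
  schauder_basis e /\ forall i j : nat, dot (e i) (e j) = (i == j)%:R.

Definition unconditionally_cvg (R : realType)
    (H : completeNormedModType R[i]) (x : nat -> H) : Prop :=
  forall s : nat -> nat, bijective s -> cvgn (series (x \o s)).

Definition multiplier_term (R : realType) (H : completeNormedModType R[i])
    (dot : {dot H for Num.conj}) (m : nat -> R[i]) (Phi Psi : nat -> H)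
    (f : H) (n : nat) : H :=
  (m n * dot f (Psi n)) *: Phi n.

Definition multiplier_unconditionally_cvg (R : realType)
    (H : completeNormedModType R[i]) (dot : {dot H for Num.conj})
    (m : nat -> R[i]) (Phi Psi : nat -> H) : Prop :=
  forall f : H, unconditionally_cvg (multiplier_term dot m Phi Psi f).

Definition NBB (R : realType) (V : normedZmodType R[i]) (x : nat -> V) : Prop :=
  0 < inf (range (fun n => nrm (x n))).

Definition semi_normalized (R : realType) (m : nat -> R[i]) : Prop :=
  exists a b : R, [/\ 0 < a, a <= b & forall n, a <= nrm (m n) <= b].

Definition ell_infty (R : realType) (m : nat -> R[i]) : Prop :=
  exists b : R, forall n, nrm (m n) <= b.

Definition bessel (R : realType) (H : completeNormedModType R[i])
    (dot : {dot H for Num.conj}) (phi : nat -> H) : Prop :=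
  exists B : R, forall h : H,
    (\sum_(0 <= n <oo) (nrm (dot h (phi n)) ^+ 2)%:E
       <= (B * nrm h ^+ 2)%:E)%E.

(* Main.v *)
(* Unconditional convergence at f bounds all signed sums sum_(n < N) +-x_n of the
   terms x_n = m_n <f, psi_n> phi_n, so by uniform boundedness the operators
   f |-> sum_(n < N) +-m_n <f, psi_n> phi_n satisfy one bound C |f|.  By the
   parallelogram law suitable signs give sum_(n < N) |x_n|^2 <= |sum +-x_n|^2
   <= C^2 |f|^2, which says that (m_n |phi_n| psi_n) is Bessel.  Taking adjoints
   of the signed sums exchanges Phi and Psi with the same C.  The other claims
   compare Bessel sums termwise; the bound on m comes from testing the Bessel
   inequality of (m_n |phi_n| psi_n) at psi_n. *)
Require Import Defs.
From mathcomp Require Import all_boot all_order all_algebra.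
From mathcomp Require Import sesquilinear.
From mathcomp Require Import all_classical all_reals all_analysis.
From mathcomp Require Import complex.
From mathcomp Require Import ring lra.
Import Order.TTheory GRing.Theory Num.Theory.
Import numFieldNormedType.Exports.
Local Open Scope ring_scope.
Local Open Scope complex_scope.

Set Implicit Arguments.
Unset Strict Implicit.
Unset Printing Implicit Defensive.

(** * The real-valued norm [nrm] *)

Lemma normE_nrm (R : realType) (V : normedZmodType R[i]) (x : V) :
  `|x| = (nrm x)%:C.
Proof. by rewrite /nrm RRe_real ?normr_real. Qed.

Lemma nrm_ge0 (R : realType) (V : normedZmodType R[i]) (x : V) : 0 <= nrm x.
Proof. by have := normr_ge0 x; rewrite normE_nrm lecR. Qed.

Lemma nrm0 (R : realType) (V : normedZmodType R[i]) : nrm (0 : V) = 0.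
Proof. by rewrite /nrm normr0. Qed.

Lemma nrm_eq0 (R : realType) (V : normedZmodType R[i]) (x : V) :
  (nrm x == 0) = (x == 0).
Proof. by rewrite -[x == 0]normr_eq0 normE_nrm (inj_eq (@complexI R)). Qed.

Lemma nrmN (R : realType) (V : normedZmodType R[i]) (x : V) :
  nrm (- x) = nrm x.
Proof. by rewrite /nrm normrN. Qed.

Lemma ler_nrmD (R : realType) (V : normedZmodType R[i]) (x y : V) :
  nrm (x + y) <= nrm x + nrm y.
Proof. by have := ler_normD x y; rewrite !normE_nrm -rmorphD lecR. Qed.

Lemma ler_nrm_sum (R : realType) (V : normedZmodType R[i]) (I : Type)
    (r : seq I) (P : pred I) (F : I -> V) :
  nrm (\sum_(i <- r | P i) F i) <= \sum_(i <- r | P i) nrm (F i).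
Proof.
elim/big_rec2: _ => [|i y x _ xy]; first by rewrite nrm0.
by rewrite (le_trans (ler_nrmD _ _)) ?lerD2l.
Qed.

Lemma nrmZ (R : realType) (V : normedModType R[i]) (c : R[i]) (x : V) :
  nrm (c *: x) = nrm c * nrm x.
Proof.
by apply/complexI; have := normrZ c x; rewrite !normE_nrm -rmorphM.
Qed.

Lemma nrmM (R : realType) (a b : R[i]) : nrm (a * b) = nrm a * nrm b.
Proof.
by apply/complexI; have := normrM a b; rewrite !normE_nrm -rmorphM.
Qed.

Lemma nrm_norm (R : realType) (V : normedZmodType R[i]) (x : V) :
  nrm `|x| = nrm x.
Proof. by rewrite /nrm normr_id. Qed.

Lemma nrm_conj (R : realType) (c : R[i]) : nrm (c^*)%R = nrm c.
Proof. by rewrite /nrm norm_conjC. Qed.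

Lemma nrm_real (R : realType) (r : R) : nrm r%:C = `|r|.
Proof. by apply/complexI; rewrite -normE_nrm normc_def /= expr0n /= addr0 sqrtr_sqr. Qed.

Lemma nrm_sign (R : realType) (V : normedModType R[i]) (b : bool) (x : V) :
  nrm ((-1) ^+ b *: x) = nrm x.
Proof. by case: b; rewrite ?expr1 ?expr0 ?scaleN1r ?nrmN ?scale1r. Qed.

(** * Rearrangements and bounded signed sums *)

(** Successive lists extend each other, so they are initial segments of one sequence [s]. This turns
    a rearrangement built block by block into a bijection of [nat]. *)
Lemma bijective_of_prefixes (L : nat -> seq nat) (d : nat -> nat) :
  (forall k, perm_eq (L k) (iota 0 (d k))) ->
  (forall k, prefix (L k) (L k.+1)) -> (forall k, k <= d k)%N ->
  exists2 s : nat -> nat, bijective s & forall k, map s (iota 0 (d k)) = L k.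
Proof.
move=> permL preL led.
have sizeL k : size (L k) = d k by rewrite (perm_size (permL k)) size_iota.
have uniqL k : uniq (L k) by rewrite (perm_uniq (permL k)) iota_uniq.
have memL k n : (n \in L k) = (n < d k)%N.
  by rewrite (perm_mem (permL k)) mem_iota.
have chainL k l : (k <= l)%N -> prefix (L k) (L l).
  move=> /subnKC <-; elim: (l - k)%N => [|j IH]; first by rewrite addn0 prefix_refl.
  by rewrite addnS (prefix_trans IH).
have nthL k l n : (k <= l)%N -> (n < d k)%N -> nth 0%N (L l) n = nth 0%N (L k) n.
  by move=> /chainL /prefixP[t ->] nk; rewrite nth_cat sizeL nk.
(* [L n.+1] has length [d n.+1 > n], so the default [0] is never reached. *)
pose s n := nth 0%N (L n.+1) n.
have sE k n : (n < d k)%N -> s n = nth 0%N (L k) n.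
  move=> nk; have [kn|/ltnW kn] := leqP k n.+1; first by rewrite /s (nthL k).
  by rewrite /s -(nthL n.+1 k).
exists s; last first.
  move=> k; apply: (@eq_from_nth _ 0%N); first by rewrite size_map size_iota.
  move=> i; rewrite size_map size_iota => ik.
  by rewrite (nth_map 0%N) ?size_iota // nth_iota // (sE k).
rewrite -setTT_bijective; split => // [i j _ _ sij|n _] /=.
  (* Both values are entries of the single duplicate-free list [L (maxn i j).+1]. *)
  apply/eqP; rewrite -(nth_uniq 0%N _ _ (uniqL (maxn i j).+1)) ?sizeL //.
  - by rewrite -!(sE (maxn i j).+1) ?sij // (leq_trans _ (led _)) // ltnS
      (leq_maxl, leq_maxr).
  - by rewrite (leq_trans _ (led _)) // ltnS leq_maxl.
  - by rewrite (leq_trans _ (led _)) // ltnS leq_maxr.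
have nL : n \in L n.+1 by rewrite memL (leq_trans _ (led _)).
exists (index n (L n.+1)) => //.
by rewrite (sE n.+1) ?nth_index // -sizeL index_mem.
Qed.

Lemma cvgn_series_tail (R : realType) (H : completeNormedModType R[i])
    (x : nat -> H) (r : R) :
  cvgn (series x) -> 0 < r ->
  exists N, forall i j, (N <= i)%N -> (i <= j)%N ->
    nrm (\sum_(i <= k < j) x k) < r.
Proof.
move=> /cauchy_cvgP/cauchy_seriesP cx r0.
have rC0 : 0 < r%:C by rewrite ltcR.
have [[A B] /= [[N _ AN] [M _ BM]] AB] := cx _ rC0.
exists (maxn N M) => i j; rewrite geq_max => /andP[Ni Mi] ij.
rewrite -ltcR -normE_nrm; apply: (AB (i, j)); split; first exact: AN.
by apply: BM; exact: leq_trans ij.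
Qed.

(* Otherwise there are consecutive intervals [d k, d k.+1[, each with a subset
   whose sum has norm at least 1; the rearrangement that lists, inside each
   interval, that subset first has a divergent series. *)
Lemma unconditionally_cvg_bounded_subsums (R : realType)
    (H : completeNormedModType R[i]) (x : nat -> H) :
  unconditionally_cvg x ->
  exists C : R, forall N (P : pred nat),
    nrm (\sum_(0 <= n < N | P n) x n) <= C.
Proof.
move=> ux; apply: contrapT => noC.
have blockP k : exists NP : nat * pred nat, (k < NP.1)%N /\
    1 <= nrm (\sum_(k <= n < NP.1 | NP.2 n) x n).
  apply: contrapT => noNP; apply: noC.
  (* Indices below [k] contribute at most the sum of their norms; those from [k] on contribute less
     than 1, since [noNP] excludes anything larger. *)
  exists (\sum_(0 <= n < k) nrm (x n) + 1) => N P.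
  have subk K : (K <= k)%N -> nrm (\sum_(0 <= n < K | P n) x n) <=
      \sum_(0 <= n < k) nrm (x n).
    move=> Kk; apply: le_trans (ler_nrm_sum _ _ _) _.
    rewrite (big_cat_nat (leq0n K) Kk) //= big_mkcond /= -[leLHS]addr0 lerD //.
      by apply: ler_sum => n _; case: ifP => // _; exact: nrm_ge0.
    by apply: sumr_ge0 => n _; exact: nrm_ge0.
  have [Nk|kN] := leqP N k; first by rewrite (le_trans (subk _ Nk)) ?lerDl.
  rewrite (big_cat_nat (leq0n k) (ltnW kN)) //= (le_trans (ler_nrmD _ _)) // lerD ?subk //.
  by rewrite leNgt; apply/negP => /ltW h; apply: noNP; exists (N, P).
have [g gP] := choice blockP.
pose d := fix d k := if k is j.+1 then (g (d j)).1 else 0%N.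
pose a k := [seq n <- index_iota (d k) (d k.+1) | (g (d k)).2 n].
pose b k := [seq n <- index_iota (d k) (d k.+1) | predC (g (d k)).2 n].
pose L := fix L k := if k is j.+1 then L j ++ (a j ++ b j) else [::].
have dlt k : (d k < d k.+1)%N by have [] := gP (d k).
have led k : (k <= d k)%N by elim: k => // k IH; exact: leq_ltn_trans (dlt k).
have permL k : perm_eq (L k) (iota 0 (d k)).
  elim: k => // k IH; rewrite -[d k.+1](subnKC (ltnW (dlt k))) iotaD add0n.
  by rewrite perm_cat // perm_filterC.
have [|s sbij sE] := bijective_of_prefixes permL _ led.
  by move=> k; exact: prefix_prefix.
(* Convergence makes every run of terms past [N] smaller than 1; the run of length [size (a N)] at
   position [d N >= N] violates this. *)
have [N NP] := cvgn_series_tail (ux s sbij) ltr01.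
have := NP (d N) (d N + size (a N))%N (led N) (leq_addr _ _).
rewrite ltNge => /negP[]; have [_ /=] := gP (d N).
suff -> : \sum_(d N <= k < d N + size (a N)) (x \o s) k =
          \sum_(d N <= n < (g (d N)).1 | (g (d N)).2 n) x n by [].
have szL : size (L N) = d N by rewrite (perm_size (permL N)) size_iota.
(* In [L N.+1 = L N ++ (a N ++ b N)], dropping the first [d N] entries and keeping the next
   [size (a N)] isolates [a N]. *)
have aE : map s (iota (d N) (size (a N))) = a N.
  have := sE N.+1; rewrite -[in iota 0 _](subnKC (ltnW (dlt N))) iotaD add0n map_cat.
  rewrite sE /= => /eqP; rewrite eqseq_cat // eqxx /= => /eqP.
  have sza : (size (a N) <= d N.+1 - d N)%N.
    by rewrite size_filter (leq_trans (count_size _ _)) // size_iota.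
  rewrite -(subnKC sza) iotaD map_cat => /eqP; rewrite eqseq_cat => [/andP[/eqP]|] //.
  by rewrite size_map size_iota.
by rewrite -[RHS]big_filter -/(a N) -{2}aE big_map /index_iota addKn.
Qed.

(** The terms of each sign form a subset sum, so twice the constant for subset sums suffices. *)
Lemma unconditionally_cvg_bounded_signed_sums (R : realType)
    (H : completeNormedModType R[i]) (x : nat -> H) :
  unconditionally_cvg x ->
  exists C : R, forall N (b : nat -> bool),
    nrm (\sum_(0 <= n < N) (-1) ^+ b n *: x n) <= C.
Proof.
move=> /unconditionally_cvg_bounded_subsums[C CP].
exists (C + C) => N b; rewrite (bigID b) /=.
apply: le_trans (ler_nrmD _ _) _; apply: lerD.
  rewrite -nrmN -sumrN (eq_bigr x) ?CP // => n ->.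
  by rewrite expr1 scaleN1r opprK.
by rewrite (eq_bigr x) ?CP // => n /negbTE ->; rewrite expr0 scale1r.
Qed.

(** * Uniform boundedness for seminorms *)

Lemma geometric_increments_cvg (R : realType) (V : completeNormedModType R[i])
    (q : R) (x : nat -> V) :
  0 <= q < 1 -> (forall n, nrm (x n.+1 - x n) <= q ^+ n) ->
  exists l, forall n, nrm (l - x n) <= q ^+ n / (1 - q).
Proof.
move=> /andP[q0 q1] xq; have q1' : 0 < 1 - q by rewrite subr_gt0.
have tail n k : nrm (x (n + k)%N - x n) <= q ^+ n / (1 - q).
  (* The exact finite geometric sum, with its factor [1 - q ^+ k], lets the induction on [k]
     close. *)
  suff : nrm (x (n + k)%N - x n) <= q ^+ n * (1 - q ^+ k) / (1 - q).
    move=> /le_trans; apply; rewrite ler_pM2r ?invr_gt0 // ler_piMr ?exprn_ge0 //.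
    by rewrite lerBlDr lerDl exprn_ge0.
  elim: k => [|k IH]; first by rewrite addn0 !subrr nrm0 mulr0 mul0r.
  rewrite addnS -(subrKA (x (n + k)%N)) (le_trans (ler_nrmD _ _)) //.
  rewrite (le_trans (lerD (xq _) IH)) // le_eqVlt exprD exprS; apply/orP; left.
  by apply/eqP; field; rewrite gt_eqF.
have small (e : R) : 0 < e -> exists N, forall n, (N <= n)%N -> q ^+ n / (1 - q) < e.
  move=> e0; have : (geometric (1 - q)^-1 q @ \oo --> (0 : R))%classic.
    by apply: cvg_geometric; rewrite ger0_norm.
  move=> /cvgrPdist_lt/(_ _ e0)[N _ NP]; exists N => n /NP /=.
  by rewrite sub0r normrN mulrC ger0_norm // divr_ge0 ?exprn_ge0 ?(ltW q1').
have cx : cvgn x.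
  apply/cauchy_cvgP/cauchyP => e e0.
  have eE : e = (complex.Re e)%:C by rewrite RRe_real ?gtr0_real.
  have [|N NP] := small (complex.Re e); first by rewrite -ltcR -eE.
  exists (x N); exists N => // n Nn; rewrite -ball_normE /= eE normE_nrm ltcR.
  rewrite -nrmN opprB -(subnKC Nn); exact: le_lt_trans (tail _ _) (NP _ _).
exists (limn x) => n; apply/ler_addgt0Pr => e e0.
have eC0 : 0 < e%:C by rewrite ltcR.
have [N _ NP] := (cvgrPdist_lt _ _).1 cx _ eC0.
have /NP : (N <= n + N)%N by rewrite leq_addl.
rewrite /= normE_nrm ltcR => lN.
rewrite -(subrKA (x (n + N)%N)) (le_trans (ler_nrmD _ _)) // addrC lerD ?(ltW lN) //.
Qed.

(** [K] is the supremum of [p] on the unit ball, finite thanks to [D], and [u] comes within [K / 3]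
    of it. By homogeneity [K] itself bounds [p], so it exceeds [C], which does not. *)
Lemma almost_norming_vector (R : realType) (V : normedModType R[i])
    (p : V -> R) (C : R) :
  (forall (c : R[i]) x, p (c *: x) = nrm c * p x) ->
  (exists D, forall x, p x <= D * nrm x) ->
  0 <= C -> ~ (forall x, p x <= C * nrm x) ->
  exists K u, [/\ C < K, nrm u <= 1, 2 / 3 * K <= p u &
    forall x, p x <= K * nrm x].
Proof.
move=> pZ [D pD] C0 noC.
have p0 : p 0 = 0 by rewrite -(scale0r (0 : V)) pZ nrm0 mul0r.
pose S := [set p u | u in [set u | nrm u <= 1]]%classic.
have supS : has_sup S.
  split; first by exists (p 0), 0; rewrite /= ?nrm0.
  exists `|D| => _ [u /= u1 <-]; apply: le_trans (pD u) _.
  rewrite (le_trans (ler_norm _)) // normrM ler_piMr // ger0_norm //.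
  exact: nrm_ge0.
have leS x : p x <= sup S * nrm x.
  have [->|x0] := eqVneq x 0; first by rewrite p0 nrm0 mulr0.
  have nx : 0 < nrm x by rewrite lt_neqAle nrm_ge0 eq_sym nrm_eq0 x0.
  rewrite -ler_pdivrMr // mulrC; apply: sup_upper_bound => //.
  exists ((nrm x)^-1%:C *: x); last first.
    by rewrite pZ nrm_real ger0_norm // invr_ge0 ltW.
  by rewrite /= nrmZ nrm_real ger0_norm ?invr_ge0 ?(ltW nx) // mulVf ?gt_eqF.
have CS : C < sup S.
  rewrite ltNge; apply/negP => SC; apply: noC => x.
  by rewrite (le_trans (leS x)) // ler_wpM2r // nrm_ge0.
have S3 : 0 < sup S / 3 by rewrite divr_gt0 // (le_lt_trans C0).
have [_ [u /= u1 <-] uS] := sup_adherent S3 supS.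
by exists (sup S), u; split=> //; lra.
Qed.

(* Sokal's gliding hump: of [p (y + w)] and [p (y - w)] one is at least [p w],
   so the signs of the increments [3^-n u_n] can be chosen so that the limit is
   large for every selected seminorm: the factor 2/3 of the norming vectors beats the
   relative size 1/2 = sum_(k > 0) 3^-k of all later increments. *)
Lemma seminorms_uniformly_bounded (R : realType)
    (V : completeNormedModType R[i]) (I : Type) (p : I -> V -> R) :
  (forall i x y, p i (x + y) <= p i x + p i y) ->
  (forall i (c : R[i]) x, p i (c *: x) = nrm c * p i x) ->
  (forall i, exists D, forall x, p i x <= D * nrm x) ->
  (forall x, exists C, forall i, p i x <= C) ->
  exists C, forall i x, p i x <= C * nrm x.
Proof.
move=> pD pZ pb pw; apply: contrapT => noC.
have pN i x : p i (- x) = p i x by rewrite -scaleN1r pZ nrmN /nrm normr1 mul1r.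
(* At the limit a hump retains at least [3^-n * K * (2/3 - 1/2)], a sixth of [3^-n * K]; the
   threshold makes this exceed [n]. *)
have humpP n : exists t : I * R * V, [/\ 6 * 3 ^+ n * n%:R < t.1.2, nrm t.2 <= 1,
    2 / 3 * t.1.2 <= p t.1.1 t.2 & forall x, p t.1.1 x <= t.1.2 * nrm x].
  apply: contrapT => noh; apply: noC; exists (6 * 3 ^+ n * n%:R) => i.
  apply: contrapT => noi.
  have C0 : 0 <= 6 * 3 ^+ n * n%:R :> R by rewrite !mulr_ge0 ?exprn_ge0.
  have [K [u [? ? ? ?]]] := almost_norming_vector (pZ i) (pb i) C0 noi.
  by apply: noh; exists (i, K, u).
have [g gP] := choice humpP.
pose w n := (3^-1 ^+ n)%:C *: (g n).2.
pose x := fix x n := if n is k.+1 then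
  (if p (g k).1.1 (w k) <= p (g k).1.1 (x k + w k) then x k + w k else x k - w k)
  else 0.
have w_le n : nrm (w n) <= 3^-1 ^+ n.
  have [_ u1 _ _] := gP n.
  rewrite /w nrmZ nrm_real ger0_norm ?exprn_ge0 ?invr_ge0 //.
  by rewrite ler_piMr ?exprn_ge0 ?invr_ge0.
have xw n : p (g n).1.1 (w n) <= p (g n).1.1 (x n.+1).
  rewrite /=; case: ifPn => //; rewrite -ltNge => lt_w.
  (* [2 *: w n] is the difference of [x n + w n] and [x n - w n], so when the plus sign fails the
     minus sign succeeds. *)
  have : p (g n).1.1 (2 *: w n) <= p (g n).1.1 (x n + w n) + p (g n).1.1 (x n - w n).
    rewrite -[p _ (x n - w n)]pN (le_trans _ (pD _ _ _)) // opprB addrC addrA.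
    by rewrite subrK scaler_nat mulr2n.
  have -> : (2 : R[i]) = (2 : R)%:C by rewrite rmorph_nat.
  by rewrite pZ nrm_real ger0_norm // => h; lra.
have [|n|l lP] := @geometric_increments_cvg _ _ 3^-1 x.
- by apply/andP; split; lra.
- rewrite /=; case: ifP => _; first by rewrite addrC addrA addNr add0r w_le.
  by rewrite addrC addrA addNr add0r nrmN w_le.
have [C CP] := pw l.
have [n Cn] : exists n, C < n%:R by exists (Num.truncn C).+1; exact: truncnS_gt.
have [Kn _ uK pK] := gP n.
have := CP (g n).1.1; apply/negP; rewrite -ltNge; apply: lt_le_trans Cn _.
have q0 : 0 < 3^-1 ^+ n :> R by rewrite exprn_gt0 ?invr_gt0.
have h1 : p (g n).1.1 (w n) = 3^-1 ^+ n * p (g n).1.1 (g n).2.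
  by rewrite /w pZ nrm_real ger0_norm ?ltW.
have h2 : p (g n).1.1 (x n.+1) <= p (g n).1.1 l + p (g n).1.1 (l - x n.+1).
  by rewrite -(pN _ (l - _)) opprB (le_trans _ (pD _ _ _)) // addrC subrK.
(* All later increments together: [3^-(n+1) / (1 - 1/3) = 3^-n / 2]. *)
have h3 : p (g n).1.1 (l - x n.+1) <= (g n).1.2 * (3^-1 ^+ n / 2).
  apply: le_trans (pK _) _; apply: ler_wpM2l.
    by apply/ltW/(le_lt_trans _ Kn); rewrite !mulr_ge0 ?exprn_ge0.
  apply: le_trans (lP _) _; rewrite exprS.
  by rewrite le_eqVlt; apply/orP; left; apply/eqP; field.
have h4 : n%:R <= 3^-1 ^+ n * (g n).1.2 / 6.
  rewrite ler_pdivlMr // exprVn mulrC ler_pdivlMl ?exprn_gt0 //.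
  by rewrite (le_trans _ (ltW Kn)) // mulrCA mulrA.
have h5 : 3^-1 ^+ n * (2 / 3 * (g n).1.2) <= 3^-1 ^+ n * p (g n).1.1 (g n).2.
  by rewrite ler_pM2l.
have := xw n; rewrite h1 => h6.
move: h2 h3 h4 h5 h6.
set A := p _ (x _); set B := p _ l; set B' := p _ (l - _); set D := p _ _.
set q := 3^-1 ^+ n; set K := (g n).1.2; move=> *; nra.
Qed.

(** * Inner product identities and inequalities *)

(* The library's linearity lemmas leave [dot] under another coercion path, which
   blocks further rewriting; these instances keep it in place. *)
Lemma dotZr (R : realType) (H : completeNormedModType R[i])
    (dot : {dot H for Num.conj}) (c : R[i]) (x y : H) :
  dot x (c *: y) = (c^*)%R * dot x y.
Proof. exact: linearZr_LR. Qed.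

Lemma dotZl (R : realType) (H : completeNormedModType R[i])
    (dot : {dot H for Num.conj}) (c : R[i]) (x y : H) :
  dot (c *: x) y = c * dot x y.
Proof. exact: linearZl_LR. Qed.

Lemma dotBr (R : realType) (H : completeNormedModType R[i])
    (dot : {dot H for Num.conj}) (x y z : H) :
  dot x (y - z) = dot x y - dot x z.
Proof. exact: linearBr. Qed.

Lemma dotBl (R : realType) (H : completeNormedModType R[i])
    (dot : {dot H for Num.conj}) (x y z : H) :
  dot (x - y) z = dot x z - dot y z.
Proof. exact: linearBl. Qed.

Lemma dot_suml (R : realType) (H : completeNormedModType R[i])
    (dot : {dot H for Num.conj}) (I : Type) (r : seq I) (F : I -> H) (y : H) :
  dot (\sum_(i <- r) F i) y = \sum_(i <- r) dot (F i) y.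
Proof. exact: linear_sumlz. Qed.

Lemma dot_sumr (R : realType) (H : completeNormedModType R[i])
    (dot : {dot H for Num.conj}) (I : Type) (r : seq I) (F : I -> H) (x : H) :
  dot x (\sum_(i <- r) F i) = \sum_(i <- r) dot x (F i).
Proof. exact: linear_sumr. Qed.

Lemma dotC (R : realType) (H : completeNormedModType R[i])
    (dot : {dot H for Num.conj}) (x y : H) :
  dot x y = ((dot y x)^*)%R.
Proof. by rewrite (hermC dot) expr0 mul1r. Qed.

Lemma dot_nrm (R : realType) (H : completeNormedModType R[i])
    (dot : {dot H for Num.conj}) (x : H) : induces_norm dot ->
  dot x x = (nrm x ^+ 2)%:C.
Proof. by move=> ->; rewrite normE_nrm rmorphXn. Qed.

Lemma parallelogram (R : realType) (H : completeNormedModType R[i])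
    (dot : {dot H for Num.conj}) (x y : H) : induces_norm dot ->
  nrm (x + y) ^+ 2 + nrm (x - y) ^+ 2 = 2 * (nrm x ^+ 2 + nrm y ^+ 2).
Proof.
move=> dotP; apply: (@complexI R).
rewrite rmorphM !rmorphD /= -!(dot_nrm _ dotP) dnormD dnormB rmorph1.
ring.
Qed.

Lemma cauchy_schwarz (R : realType) (H : completeNormedModType R[i])
    (dot : {dot H for Num.conj}) (x y : H) : induces_norm dot ->
  nrm (dot x y) <= nrm x * nrm y.
Proof.
move=> dotP.
have [->|y0] := eqVneq y 0; first by rewrite linear0r !nrm0 mulr0.
have ny : 0 < nrm y by rewrite lt_neqAle nrm_ge0 eq_sym nrm_eq0 y0.
set c := dot x y.
have dyx : dot y x = (c^*)%R by rewrite dotC.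
have cc : c * (c^*)%R = (nrm c ^+ 2)%:C by rewrite -normCK normE_nrm rmorphXn.
(* This square expands to [|y|^2 (|x|^2 |y|^2 - |c|^2)], and [|y|^2] is positive. *)
have : 0 <= dot (dot y y *: x - c *: y) (dot y y *: x - c *: y).
  by rewrite dotP exprn_ge0.
rewrite dotBl !dotBr !dotZl !dotZr -/c dyx !(dot_nrm _ dotP).
have -> : ((nrm y ^+ 2)%:C^*)%R = (nrm y ^+ 2)%:C :> R[i].
  by rewrite conj_Creal // complex_real.
set Y := nrm y ^+ 2; set X := nrm x ^+ 2.
have -> : Y%:C * (Y%:C * X%:C) - Y%:C * ((c^*)%R * c) -
    (c * (Y%:C * (c^*)%R) - c * ((c^*)%R * Y%:C)) =
    Y%:C * (Y%:C * X%:C - c * (c^*)%R) by ring.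
rewrite cc -rmorphM -rmorphB -rmorphM lecR pmulr_rge0 ?exprn_gt0 // subr_ge0.
rewrite /X /Y -exprMn ler_pXn2r ?nnegrE ?mulr_ge0 ?nrm_ge0 //.
by rewrite mulrC.
Qed.

(* By the parallelogram law one of [S + x_N] and [S - x_N] has squared norm at
   least [|S|^2 + |x_N|^2]. *)
Lemma sum_sqr_le_signed_sum (R : realType) (H : completeNormedModType R[i])
    (dot : {dot H for Num.conj}) (x : nat -> H) (N : nat) :
  induces_norm dot -> exists b : nat -> bool,
    \sum_(0 <= n < N) nrm (x n) ^+ 2 <=
    nrm (\sum_(0 <= n < N) (-1) ^+ b n *: x n) ^+ 2.
Proof.
move=> dotP; elim: N => [|N [b IH]].
  by exists xpred0; rewrite !big_geq // nrm0 expr0n.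
pose b' s n := if n == N then s else b n.
have sumE s : \sum_(0 <= n < N.+1) (-1) ^+ b' s n *: x n =
    \sum_(0 <= n < N) (-1) ^+ b n *: x n + (-1) ^+ s *: x N.
  rewrite big_nat_recr //= /b' eqxx; congr (_ + _).
  by apply: eq_big_nat => n /= nN; rewrite ltn_eqF.
set S := \sum_(0 <= n < N) (-1) ^+ b n *: x n in IH sumE.
have := parallelogram S (x N) dotP; rewrite big_nat_recr //= => E.
have [h|/ltW h] := leP (nrm (S - x N) ^+ 2) (nrm (S + x N) ^+ 2).
  by exists (b' false); rewrite sumE expr0 scale1r; lra.
by exists (b' true); rewrite sumE expr1 scaleN1r; lra.
Qed.

(** * Bessel sequences and lower bounds *)

Lemma bessel_finite (R : realType) (H : completeNormedModType R[i])
    (dot : {dot H for Num.conj}) (phi : nat -> H) (B : R) :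
  (forall h N, \sum_(0 <= n < N) nrm (dot h (phi n)) ^+ 2 <= B * nrm h ^+ 2) ->
  bessel dot phi.
Proof.
move=> phiB; exists B => h; apply: lime_le.
  by apply: is_cvg_nneseries => n _ _; rewrite lee_fin exprn_ge0 ?nrm_ge0.
by apply: nearW => N; rewrite sumEFin lee_fin.
Qed.

Lemma bessel_le (R : realType) (H : completeNormedModType R[i])
    (dot : {dot H for Num.conj}) (phi psi : nat -> H) (c : R) :
  (forall h n, nrm (dot h (psi n)) <= c * nrm (dot h (phi n))) ->
  bessel dot phi -> bessel dot psi.
Proof.
move=> psi_phi [B phiB]; apply: (@bessel_finite _ _ _ _ (c ^+ 2 * B)) => h N.
rewrite -mulrA; apply: (@le_trans _ _
    (c ^+ 2 * \sum_(0 <= n < N) nrm (dot h (phi n)) ^+ 2)).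
  rewrite mulr_sumr; apply: ler_sum => n _; rewrite -exprMn ler_pXn2r ?nnegrE ?nrm_ge0 //.
  by rewrite (le_trans _ (psi_phi h n)) ?nrm_ge0.
rewrite ler_wpM2l ?sqr_ge0 // -lee_fin -sumEFin (le_trans _ (phiB h)) //.
by apply: nneseries_lim_ge => n _ _; rewrite lee_fin exprn_ge0 ?nrm_ge0.
Qed.

Lemma bessel_coef_bound (R : realType) (H : completeNormedModType R[i])
    (dot : {dot H for Num.conj}) (phi : nat -> H) : bessel dot phi ->
  exists B, forall h n, nrm (dot h (phi n)) ^+ 2 <= B * nrm h ^+ 2.
Proof.
move=> [B phiB]; exists B => h n; rewrite -lee_fin (le_trans _ (phiB h)) //.
apply: le_trans (nneseries_lim_ge n.+1 _) => [|k _ _]; last first.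
  by rewrite lee_fin exprn_ge0 ?nrm_ge0.
rewrite sumEFin lee_fin big_nat_recr //= lerDr.
by apply: sumr_ge0 => k _; rewrite exprn_ge0 ?nrm_ge0.
Qed.

Lemma nrm_dotZ (R : realType) (H : completeNormedModType R[i])
    (dot : {dot H for Num.conj}) (c : R[i]) (h y : H) :
  nrm (dot h (c *: y)) = nrm c * nrm (dot h y).
Proof. by rewrite dotZr nrmM nrm_conj. Qed.

Lemma NBB_lower_bound (R : realType) (V : normedZmodType R[i]) (x : nat -> V) :
  NBB x -> exists2 a : R, 0 < a & forall n, a <= nrm (x n).
Proof.
move=> x0; exists (inf (range (fun n => nrm (x n)))) => // n.
by apply: ge_inf; [exists 0 => _ [k _ <-]; exact: nrm_ge0 | exists n].
Qed.

(** * Signed partial sums of the multiplier *)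

Definition signed_sum (R : realType) (H : completeNormedModType R[i])
    (dot : {dot H for Num.conj}) (m : nat -> R[i]) (Phi Psi : nat -> H)
    (N : nat) (b : nat -> bool) (f : H) : H :=
  \sum_(0 <= n < N) (-1) ^+ b n *: multiplier_term dot m Phi Psi f n.

Definition signed_sums_bounded (R : realType) (H : completeNormedModType R[i])
    (dot : {dot H for Num.conj}) (m : nat -> R[i]) (Phi Psi : nat -> H)
    (C : R) : Prop :=
  forall N b f, nrm (signed_sum dot m Phi Psi N b f) <= C * nrm f.

Lemma multiplier_signed_sums_bounded (R : realType)
    (H : completeNormedModType R[i]) (dot : {dot H for Num.conj})
    (m : nat -> R[i]) (Phi Psi : nat -> H) : induces_norm dot ->
  multiplier_unconditionally_cvg dot m Phi Psi ->
  exists C, signed_sums_bounded dot m Phi Psi C.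
Proof.
move=> dotP Mcvg.
(* Indexing by length and sign pattern yields one constant for all signs, which later may be chosen
   depending on the vector. *)
pose p (i : nat * (nat -> bool)) f := nrm (signed_sum dot m Phi Psi i.1 i.2 f).
have [i f g|i c f|i|f|C CP] := @seminorms_uniformly_bounded _ _ _ p.
- rewrite /p; suff -> : signed_sum dot m Phi Psi i.1 i.2 (f + g) =
      signed_sum dot m Phi Psi i.1 i.2 f + signed_sum dot m Phi Psi i.1 i.2 g.
    exact: ler_nrmD.
  rewrite -big_split /=; apply: eq_bigr => n _.
  by rewrite /multiplier_term linearDl mulrDr scalerDl scalerDr.
- rewrite /p -nrmZ; congr nrm; rewrite scaler_sumr; apply: eq_bigr => n _.
  by rewrite /multiplier_term dotZl !scalerA; congr (_ *: _); ring.
(* This bound may depend on [i]: only continuity of each single seminorm is at stake. *)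
- exists (\sum_(0 <= n < i.1) nrm (m n) * nrm (Psi n) * nrm (Phi n)) => f.
  apply: le_trans (ler_nrm_sum _ _ _) _; rewrite mulr_suml.
  apply: ler_sum => n _; rewrite nrm_sign nrmZ nrmM [leRHS]mulrAC ler_wpM2r ?nrm_ge0 //.
  by rewrite -mulrA ler_wpM2l ?nrm_ge0 // mulrC cauchy_schwarz.
- have [C CP] := unconditionally_cvg_bounded_signed_sums (Mcvg f).
  by exists C => i; exact: CP.
- by exists C => N b f; exact: (CP (N, b)).
Qed.

(** The signs are real, so exchanging [Phi] and [Psi] and conjugating [m] gives the adjoint of the
    signed sum [T]. With [g] its value at [h], [|g|^2 = <T g, h> <= C |g| |h|], and [|g|]
    cancels. *)
Lemma signed_sums_bounded_adjoint (R : realType)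
    (H : completeNormedModType R[i]) (dot : {dot H for Num.conj})
    (m : nat -> R[i]) (Phi Psi : nat -> H) (C : R) : induces_norm dot ->
  signed_sums_bounded dot m Phi Psi C ->
  signed_sums_bounded dot (fun n => (m n)^*)%R Psi Phi C.
Proof.
move=> dotP TC N b h; set g := signed_sum _ _ _ _ _ _ _.
have dot_adj f : dot (signed_sum dot m Phi Psi N b f) h = dot f g.
  rewrite dot_suml dot_sumr; apply: eq_bigr => n _.
  rewrite /multiplier_term !dotZl !dotZr rmorphM /= conjCK -dotC.
  by rewrite rmorphXn rmorphN1; ring.
have [->|g0] := eqVneq g 0.
  (* [C * nrm h] is nonnegative because it bounds the norm of the empty signed sum. *)
  by rewrite nrm0 (le_trans _ (TC 0%N b h)) ?nrm_ge0.
have ng : 0 < nrm g by rewrite lt_neqAle nrm_ge0 eq_sym nrm_eq0 g0.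
rewrite -(ler_pM2l ng) -expr2.
have -> : nrm g ^+ 2 = nrm (dot g g).
  by rewrite (dot_nrm _ dotP) nrm_real ger0_norm ?exprn_ge0 ?nrm_ge0.
rewrite -dot_adj (le_trans (cauchy_schwarz _ _ dotP)) //.
by rewrite mulrA (mulrC (nrm g)) ler_wpM2r ?nrm_ge0.
Qed.

Lemma signed_sums_bounded_bessel (R : realType)
    (H : completeNormedModType R[i]) (dot : {dot H for Num.conj})
    (m : nat -> R[i]) (Phi Psi : nat -> H) (C : R) : induces_norm dot ->
  signed_sums_bounded dot m Phi Psi C ->
  bessel dot (fun n => (m n * `|Phi n|) *: Psi n).
Proof.
move=> dotP TC; apply: (@bessel_finite _ _ _ _ (C ^+ 2)) => h N.
have [b] := sum_sqr_le_signed_sum (multiplier_term dot m Phi Psi h) N dotP.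
(* The norm [|m_n| |<h, psi_n>| |phi_n|] of a term is also the modulus of
   [<h, m_n |phi_n| psi_n>]. *)
under eq_bigr => n _ do rewrite /multiplier_term nrmZ nrmM mulrAC
  -(nrm_norm (Phi n)) -nrmM -nrm_dotZ.
move=> /le_trans; apply; rewrite -exprMn ler_pXn2r ?nnegrE ?nrm_ge0 //; first exact: TC.
by rewrite (le_trans _ (TC 0%N b h)) ?nrm_ge0.
Qed.

Theorem proposition3p2 (R : realType) (H : completeNormedModType R[i])
    (dot : {dot H for Num.conj}) (dotP : induces_norm dot)
    (e : nat -> H) (eP : orthonormal_basis dot e)
    (Phi Psi : nat -> H) (m : nat -> R[i])
    (Mcvg : multiplier_unconditionally_cvg dot m Phi Psi) :
  (bessel dot (fun n => (m n * `|Phi n|) *: Psi n) /\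
   bessel dot (fun n => (m n * `|Psi n|) *: Phi n)) /\
  ((NBB Phi -> bessel dot (fun n => m n *: Psi n)) /\
   (NBB Psi -> bessel dot (fun n => m n *: Phi n)) /\
   (NBB (fun n => m n *: Phi n) -> bessel dot Psi) /\
   (NBB (fun n => m n *: Psi n) -> bessel dot Phi)) /\
  (NBB Phi -> NBB Psi -> ell_infty m) /\
  (NBB Phi -> NBB Psi -> NBB m ->
     semi_normalized m /\ bessel dot Phi /\ bessel dot Psi).
Proof.
have [C TC] := multiplier_signed_sums_bounded dotP Mcvg.
have besPsi := signed_sums_bounded_bessel dotP TC.
have besPhi : bessel dot (fun n => (m n * `|Psi n|) *: Phi n).
  (* The adjoint carries the conjugate of [m], which has the same modulus. *)
  apply: (bessel_le (c := 1)) (signed_sums_bounded_bessel dotP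
    (signed_sums_bounded_adjoint dotP TC)) => h n.
  by rewrite !nrm_dotZ !nrmM nrm_conj mul1r.
have weaken (X Y : nat -> H) : NBB X ->
    bessel dot (fun n => (m n * `|X n|) *: Y n) -> bessel dot (fun n => m n *: Y n).
  move=> /NBB_lower_bound[a a0 aX]; apply: (@bessel_le _ _ _ _ _ a^-1) => h n.
  rewrite !nrm_dotZ nrmM nrm_norm ler_pdivlMl // mulrA ler_wpM2r ?nrm_ge0 //.
  by rewrite mulrC ler_wpM2l ?nrm_ge0.
have divide (X Y : nat -> H) : NBB (fun n => m n *: X n) ->
    bessel dot (fun n => (m n * `|X n|) *: Y n) -> bessel dot Y.
  move=> /NBB_lower_bound[a a0 aX]; apply: (@bessel_le _ _ _ _ _ a^-1) => h n.
  rewrite !nrm_dotZ nrmM nrm_norm ler_pdivlMl // ler_wpM2r ?nrm_ge0 //.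
  by rewrite -nrmZ.
have m_bounded : NBB Phi -> NBB Psi -> ell_infty m.
  move=> /NBB_lower_bound[a a0 aPhi] /NBB_lower_bound[c c0 cPsi].
  have [B BP] := bessel_coef_bound besPsi.
  (* At [h = psi_n] the bound reads [|m_n|^2 |phi_n|^2 |psi_n|^4 <= B |psi_n|^2], whence
     [|m_n| |phi_n| |psi_n| <= sqrt B]. *)
  exists (Num.sqrt B / (a * c)) => n; rewrite ler_pdivlMr ?mulr_gt0 //.
  apply: (@le_trans _ _ (nrm (m n) * (nrm (Phi n) * nrm (Psi n)))).
    by rewrite ler_wpM2l ?nrm_ge0 // ler_pM // ltW.
  have Psi0 : 0 < nrm (Psi n) by exact: lt_le_trans (cPsi n).
  have := BP (Psi n) n; rewrite nrm_dotZ nrmM nrm_norm (dot_nrm _ dotP).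
  rewrite nrm_real ger0_norm ?exprn_ge0 ?nrm_ge0 // => h.
  rewrite -[leLHS]ger0_norm ?mulr_ge0 ?nrm_ge0 // -sqrtr_sqr ler_wsqrtr //.
  rewrite -(ler_pM2r (exprn_gt0 2 Psi0)) (le_trans _ h) //.
  by rewrite le_eqVlt; apply/orP; left; apply/eqP; ring.
have unscale (X : nat -> H) : NBB m -> bessel dot (fun n => m n *: X n) -> bessel dot X.
  move=> /NBB_lower_bound[a a0 am]; apply: (@bessel_le _ _ _ _ _ a^-1) => h n.
  by rewrite nrm_dotZ ler_pdivlMl // ler_wpM2r ?nrm_ge0.
split; first by split.
split; first by split=> [/weaken|]; last split=> [/weaken|];
  last split=> /divide; exact.
split=> // nPhi nPsi nm; split; last first.
  (* The lower bound on one sequence makes [m] times the other Bessel; the lower bound on [m] then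
     removes the factor. *)
  by split; apply: unscale nm _; [exact: weaken nPsi _ | exact: weaken nPhi _].
have [c cm] := m_bounded nPhi nPsi; have [a a0 am] := NBB_lower_bound nm.
exists a, c; split=> // [|n]; first exact: le_trans (am 0%N) (cm 0%N).
by rewrite am cm.
Qed.
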